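(* Let $A_\bullet=(A_k)_{k=0}^\infty$ be a sequence of matrices in $\mathbb{C}^{d\times d}$ and $S\in\mathbb{C}^{d\times d}$. If $\sum_{k=0}^\infty A_k=S$ in the conventional sense, then $\sum_{k=0}^\infty A_k$ is weakly Borel summable to $S$.
   Context: A series of matrices equals $S$ in the conventional sense (is conventionally summable to $S$) if its partial sums converge to $S$ in any matrix norm. With $S_n=\sum_{k=0}^nA_k$, the weak Borel transform of $A_\bullet$ is $\mathscr{WB}(A_\bullet)(x)=\sum_{k=0}^\infty S_k\frac{x^k}{k!}$ for $x>0$. The series $\sum_{k=0}^\infty A_k$ is weakly Borel summable to $S$ if the series $e^{-x}\mathscr{WB}(A_\bullet)(x)$ is conventionally summable for all $x>0$ and $\lim_{x\to\infty}e^{-x}\mathscr{WB}(A_\bullet)(x)=S$. *)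

(* Defs.v *)
From mathcomp Require Import all_boot all_order all_algebra.
From mathcomp Require Import complex.
From mathcomp Require Import all_classical all_reals all_analysis.

Set Implicit Arguments.
Unset Strict Implicit.
Unset Printing Implicit Defensive.
Import Order.TTheory GRing.Theory Num.Theory.
Import numFieldNormedType.Exports.
Local Open Scope classical_set_scope.
Local Open Scope ring_scope.
Local Open Scope complex_scope.

(* Submultiplicativity is not required: these are the vector-space norms on
   d x d complex matrices.  [normc a] is the modulus of a as an element of R. *)
Record matrix_norm (R : realType) (d : nat) (N : 'M[R[i]]_d -> R) : Prop := {
  matrix_norm_ge0 : forall A, 0 <= N A;
  matrix_norm_eq0 : forall A, N A = 0 -> A = 0;
  matrix_normZ : forall (a : R[i]) (A : 'M[R[i]]_d), N (a *: A) = ComplexField.Normc.normc a * N A;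
  matrix_normD : forall A B : 'M[R[i]]_d, N (A + B) <= N A + N B }.

Definition cvg_mx (R : realType) (d : nat) (T : Type) (F : set_system T)
    (f : T -> 'M[R[i]]_d) (L : 'M[R[i]]_d) : Prop :=
  forall N : 'M[R[i]]_d -> R, matrix_norm N ->
    N (f t - L) @[t --> F] --> (0 : R).

(* S_n = A_0 + ... + A_n, with n + 1 terms; [series A n] stops at A_(n-1). *)
Definition partial_sum (R : realType) (d : nat) (A : nat -> 'M[R[i]]_d)
    (n : nat) : 'M[R[i]]_d := series A n.+1.

Definition conv_summable_to (R : realType) (d : nat) (A : nat -> 'M[R[i]]_d)
    (S : 'M[R[i]]_d) : Prop := cvg_mx \oo (partial_sum A) S.

(* 0 if the series does not converge. *)
Definition conv_sum (R : realType) (d : nat) (A : nat -> 'M[R[i]]_d)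
    : 'M[R[i]]_d := xget 0 [set S | conv_summable_to A S].

Definition weak_Borel_term (R : realType) (d : nat) (A : nat -> 'M[R[i]]_d)
    (x : R) (k : nat) : 'M[R[i]]_d :=
  (x ^+ k / k`!%:R)%:C *: partial_sum A k.

Definition weak_Borel (R : realType) (d : nat) (A : nat -> 'M[R[i]]_d)
    (x : R) : 'M[R[i]]_d := conv_sum (weak_Borel_term A x).

Definition weakly_Borel_summable_to (R : realType) (d : nat)
    (A : nat -> 'M[R[i]]_d) (S : 'M[R[i]]_d) : Prop :=
  (forall x : R, 0 < x ->
     exists T : 'M[R[i]]_d,
       conv_summable_to (fun k => (expR (- x))%:C *: weak_Borel_term A x k) T)
  /\ cvg_mx +oo (fun x : R => (expR (- x))%:C *: weak_Borel A x) S.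

(* Main.v *)
Require Import Defs.
From mathcomp Require Import all_boot all_order all_algebra.
From mathcomp Require Import complex.
From mathcomp Require Import all_classical all_reals all_analysis.
From mathcomp Require Import ring.

Set Implicit Arguments.
Unset Strict Implicit.
Unset Printing Implicit Defensive.
Import Order.TTheory GRing.Theory Num.Theory.
Import numFieldNormedType.Exports.
Local Open Scope classical_set_scope.
Local Open Scope ring_scope.

(** Once [S_k --> S], the matrix [e^{-x} WB(x) = e^{-x} sum_k S_k x^k / k!] is
    an average of the partial sums [S_k] with the Poisson weights
    [e^{-x} x^k / k!], which are nonnegative and have total mass 1.  As [x]
    grows, the mass carried by any fixed initial range [k < N] tends to 0, since
    [e^{-x} x^k / k! <= (k + 1) / x]; so the average only feels the far terms,
    which are close to [S].  Since the [S_k] are bounded, the exponential series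
    dominates [sum_k S_k x^k / k!], which therefore converges for every
    [x > 0].

    This argument is carried out for real sequences: [is_cvg_series_exp_coeffM]
    gives the convergence of the series and [cvg_exp_mean] the limit of the
    averages, by way of the bound [exp_weighted_sum_le].  Matrices reduce to
    this case because convergence in every norm is the same as convergence of
    the real and imaginary parts of all entries ([cvg_mxP]), and taking these
    parts commutes with real scaling and with sums. *)

(** * Poisson averages of real sequences *)

(** This is the decay of the Poisson weights: after division by [x * expR x] it
    bounds the weight of [k] by [(k + 1) / x].  It holds because
    [x * (x^k / k!)] is [k + 1] times the next term of the exponential
    series. *)
Lemma mulr_exp_coeff_le (R : realType) (x : R) (k : nat) : 0 < x ->
  x * exp_coeff x k <= k.+1%:R * expR x.
Proof.
move=> x0.
have -> : x * exp_coeff x k = k.+1%:R * exp_coeff x k.+1.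
  rewrite /exp_coeff /= exprS factS natrM.
  have k0 : (k`!%:R : R) != 0 by rewrite pnatr_eq0 -lt0n fact_gt0.
  have k1 : (k.+1%:R : R) != 0 by rewrite pnatr_eq0.
  by rewrite invfM; field; rewrite k0 addrC natr1 k1.
rewrite ler_wpM2l//; apply: le_trans (expR_ge1Dxn k (ltW x0)).
by rewrite lerDr.
Qed.

Lemma series_exp_coeff_le_expR (R : realType) (x : R) (n : nat) : 0 <= x ->
  series (exp_coeff x) n <= expR x.
Proof.
move=> x0; apply: nondecreasing_cvgn_le (is_cvg_series_exp_coeff x) n.
by apply: nondecreasing_series => k _ _; exact: exp_coeff_ge0.
Qed.

(** A convergent [u] is bounded, so a multiple of the exponential series
    dominates this one. *)
Lemma is_cvg_series_exp_coeffM (R : realType) (u : R ^nat) (x : R) :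
  cvgn u -> 0 <= x -> cvgn (series (fun k => exp_coeff x k * u k)).
Proof.
move=> /cvg_seq_bounded/pinfty_ex_gt0[M M_gt0 /= uM] x0.
apply: normed_cvg.
apply: (@series_le_cvg _ _ (M *: exp_coeff x)) => [k|k|k|] /=.
- exact: normr_ge0.
- by rewrite mulr_ge0 ?exp_coeff_ge0// ltW.
- rewrite normrM ger0_norm ?exp_coeff_ge0// mulrC.
  by rewrite ler_wpM2r ?exp_coeff_ge0// uM.
- exact: is_cvg_seriesZ (is_cvg_series_exp_coeff x).
Qed.

(** The indices below [N] contribute [O(expR x / x)] by the decay of the weights;
    the others contribute at most [e] times the whole exponential series.  The
    bound is uniform in [n], so it passes to the sum of the series. *)
Lemma exp_weighted_sum_le (R : realType) (v : R ^nat) (e x : R) (N n : nat) :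
  0 < x -> (N <= n)%N -> (forall k, (N <= k)%N -> `|v k| <= e) ->
  \sum_(0 <= k < n) exp_coeff x k * `|v k| <=
  ((\sum_(0 <= k < N) k.+1%:R * `|v k|) / x + e) * expR x.
Proof.
move=> x0 Nn ve; have ex k : 0 <= exp_coeff x k by exact/exp_coeff_ge0/ltW.
have e0 : 0 <= e by exact: le_trans (ve N (leqnn N)).
rewrite (big_cat_nat (n := N))//= mulrDl lerD//.
  rewrite mulrAC ler_pdivlMr// mulr_suml mulr_suml.
  apply: ler_sum => k _; rewrite mulrAC [leRHS]mulrAC.
  by rewrite ler_wpM2r// mulrC; exact: mulr_exp_coeff_le.
apply: (@le_trans _ _ (e * series (exp_coeff x) n)); last first.
  by rewrite ler_wpM2l//; apply: series_exp_coeff_le_expR; exact: ltW.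
rewrite /series/= mulr_sumr [leRHS](big_cat_nat (n := N))//= ler_wpDl//.
  by apply: sumr_ge0 => k _; rewrite mulr_ge0.
rewrite big_nat_cond [leRHS]big_nat_cond.
by apply: ler_sum => k /andP[/andP[Nk _] _]; rewrite mulrC ler_wpM2r ?ve.
Qed.

(** Regularity of the averaging method: it preserves limits. *)
Lemma cvg_exp_mean (R : realType) (u : R ^nat) (l : R) :
  u @ \oo --> l ->
  expR (- x) * limn (series (fun k => exp_coeff x k * u k))
    @[x --> +oo] --> l.
Proof.
move=> ul; apply/cvgrPdistC_le => e e0.
have e20 : 0 < e / 2 by rewrite divr_gt0.
have [N _ uN] : \forall n \near \oo, `|u n - l| <= e / 2.
  by move/cvgrPdistC_le : ul; exact.
pose C := \sum_(0 <= k < N) k.+1%:R * `|u k - l|.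
near=> x.
have x0 : 0 < x by near: x; exact: nbhs_pinfty_gt.
have Cx : C / x <= e / 2.
  have xC : C / (e / 2) <= x.
    by near: x; apply: nbhs_pinfty_ge; exact: num_real.
  by rewrite ler_pdivrMr// mulrC -ler_pdivrMr.
have cu := is_cvg_series_exp_coeffM (cvgP l ul) (ltW x0).
set B := limn _.
(* Multiplying by [expR x] turns the claim into one about series, as [l * expR x]
   is the sum for the constant sequence [l]. *)
suff Bl : `|B - l * expR x| <= e * expR x.
  have -> : expR (- x) * B - l = expR (- x) * (B - l * expR x).
    by rewrite mulrBr [l * _]mulrC mulrA [expR (- x) * expR x]mulrC
      expRxMexpNx_1 mul1r.
  rewrite normrM ger0_norm ?expR_ge0// expRN mulrC ler_pdivrMr//.
  exact: expR_gt0.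
have cvB : (series (fun k => exp_coeff x k * u k) \-
      (fun n => l * series (exp_coeff x) n)) n @[n --> \oo]
    --> B - l * expR x.
  apply: cvgB => //; apply: cvgMl_tmp; exact: is_cvg_series_exp_coeff.
apply: (cvgr_to_le (cvg_norm cvB)).
exists N => // n /= Nn.
have -> : series (fun k => exp_coeff x k * u k) n - l * series (exp_coeff x) n
    = \sum_(0 <= k < n) exp_coeff x k * (u k - l).
  by rewrite /series /= mulr_sumr -sumrB; apply: eq_bigr => k _; ring.
apply: le_trans (ler_norm_sum _ _ _) _.
have -> : \sum_(0 <= k < n) `|exp_coeff x k * (u k - l)| =
    \sum_(0 <= k < n) exp_coeff x k * `|u k - l|.
  apply: eq_bigr => k _.
  by rewrite normrM [X in X * _]ger0_norm// exp_coeff_ge0// ltW.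
apply: le_trans (exp_weighted_sum_le (v := fun k => u k - l) x0 Nn uN) _.
by rewrite ler_wpM2r ?expR_ge0// -/C [leRHS]splitr lerD2r.
Unshelve. all: by end_near. Qed.

(** * Convergence of matrices through real coordinates *)

Local Open Scope complex_scope.
Import ComplexField.Normc.

(** The [2 d^2] real coordinates of a complex matrix; the boolean puts real and
    imaginary parts under a single statement. *)
Definition coord (R : realType) (d : nat) (b : bool) (i j : 'I_d)
    (A : 'M[R[i]]_d) : R := if b then complex.Re (A i j) else complex.Im (A i j).

Section Coordinates.
Variables (R : realType) (d : nat).
Implicit Types (A B : 'M[R[i]]_d) (i j : 'I_d) (b : bool).

Lemma coordD b i j A B : coord b i j (A + B) = coord b i j A + coord b i j B.
Proof. by rewrite /coord !mxE; case: (A i j) (B i j) b => [? ?] [? ?] []. Qed.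

Lemma coordN b i j A : coord b i j (- A) = - coord b i j A.
Proof. by rewrite /coord !mxE; case: (A i j) b => [? ?] []. Qed.

Lemma coord0 b i j : coord b i j (0 : 'M[R[i]]_d) = 0.
Proof. by rewrite /coord !mxE; case: b. Qed.

Lemma coordZ (r : R) b i j A : coord b i j (r%:C *: A) = r * coord b i j A.
Proof.
by rewrite /coord !mxE; case: (A i j) b => [x y] [] /=; rewrite mul0r ?subr0 ?addr0.
Qed.

Lemma coord_series (A : nat -> 'M[R[i]]_d) b i j n :
  coord b i j (series A n) = series (fun k => coord b i j (A k)) n.
Proof. exact: (big_morph (coord b i j) (coordD b i j) (coord0 b i j)). Qed.

Lemma coord_inj A B : (forall b i j, coord b i j A = coord b i j B) -> A = B.
Proof.
move=> AB; apply/matrixP => i j; apply/eqP; rewrite eq_complex.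
by apply/andP; split; apply/eqP; [exact: (AB true)|exact: (AB false)].
Qed.

Definition mx_of_coord (c : bool -> 'I_d -> 'I_d -> R) : 'M[R[i]]_d :=
  \matrix_(i, j) (c true i j +i* c false i j).

Lemma coord_mx_of_coord c b i j : coord b i j (mx_of_coord c) = c b i j.
Proof. by rewrite /coord mxE; case: b. Qed.

(** The one norm to which convergence in all norms gets applied: it controls
    every coordinate. *)
Definition entry_norm A : R := \sum_i \sum_j normc (A i j).

Lemma normc_ge0 (z : R[i]) : 0 <= normc z.
Proof. by case: z => x y; exact: sqrtr_ge0. Qed.

Lemma normc_le_entry_norm A i j : normc (A i j) <= entry_norm A.
Proof.
rewrite /entry_norm (bigD1 i)//= (bigD1 j)//= -addrA lerDl addr_ge0//.
  by apply: sumr_ge0 => ? _; exact: normc_ge0.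
by do 2!apply: sumr_ge0 => ? _; exact: normc_ge0.
Qed.

Lemma matrix_norm_entry_norm : matrix_norm entry_norm.
Proof.
split=> [A|A A0|a A|A B].
- by do 2!apply: sumr_ge0 => ? _; exact: normc_ge0.
- apply/matrixP => i j; rewrite mxE; apply: eq0_normc; apply/eqP.
  by rewrite eq_le normc_ge0 andbT -A0 normc_le_entry_norm.
- rewrite /entry_norm mulr_sumr; apply: eq_bigr => i _.
  by rewrite mulr_sumr; apply: eq_bigr => j _; rewrite mxE normcM.
- rewrite /entry_norm -big_split/=; apply: ler_sum => i _.
  by rewrite -big_split/=; apply: ler_sum => j _; rewrite mxE le_normcD.
Qed.

Lemma coord_le_entry_norm b i j A : `|coord b i j A| <= entry_norm A.
Proof.
apply: le_trans (normc_le_entry_norm A i j); rewrite /coord.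
case: (A i j) => x y; rewrite /normc -(sqrtr_sqr (if b then _ else _)).
by apply: ler_wsqrtr; case: b; rewrite /= ?lerDl ?lerDr sqr_ge0.
Qed.

Lemma normc_le_ReIm (x y : R) : normc (x +i* y) <= `|x| + `|y|.
Proof.
rewrite /normc -[leRHS]ger0_norm ?addr_ge0// -sqrtr_sqr.
apply: ler_wsqrtr; rewrite sqrrD !real_normK ?num_real//.
by rewrite lerD2r lerDl mulrn_wge0// mulr_ge0.
Qed.

Lemma matrix_norm0 (N : 'M[R[i]]_d -> R) : matrix_norm N -> N 0 = 0.
Proof.
by move=> hN; rewrite -(scale0r (0 : 'M[R[i]]_d)) (matrix_normZ hN) normc0 mul0r.
Qed.

Lemma matrix_norm_sum (N : 'M[R[i]]_d -> R) (I : finType)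
    (f : I -> 'M[R[i]]_d) :
  matrix_norm N -> N (\sum_i f i) <= \sum_i N (f i).
Proof.
move=> hN; elim/big_rec2: _ => [|k a B _ Ba]; first by rewrite matrix_norm0.
by apply: le_trans (matrix_normD hN _ _) _; rewrite lerD2l.
Qed.

(** Expanding [A] in the elementary matrices, every norm is dominated by the
    coordinates.  This is the half of the equivalence of norms in finite
    dimension that needs no compactness. *)
Lemma matrix_norm_le_coord (N : 'M[R[i]]_d -> R) A : matrix_norm N ->
  N A <= \sum_i \sum_j
    (`|coord true i j A| + `|coord false i j A|) * N (delta_mx i j).
Proof.
move=> hN; rewrite [in leLHS](matrix_sum_delta A).
apply: le_trans (matrix_norm_sum _ hN) _; apply: ler_sum => i _.
apply: le_trans (matrix_norm_sum _ hN) _; apply: ler_sum => j _.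
rewrite (matrix_normZ hN) ler_wpM2r ?(matrix_norm_ge0 hN)// /coord.
by case: (A i j) => x y; exact: normc_le_ReIm.
Qed.

Lemma cvg_sum0 (T : Type) (F : set_system T) (FF : Filter F) (I : finType)
    (g : I -> T -> R) :
  (forall k, g k t @[t --> F] --> (0 : R)) ->
  \sum_k g k t @[t --> F] --> (0 : R).
Proof.
move=> g0; elim: (index_enum I) => [|k r IHr].
  by under eq_fun do rewrite big_nil; exact: cvg_cst.
under eq_fun do rewrite big_cons.
by have := cvgD (g0 k) IHr; rewrite addr0; exact.
Qed.

(** This reduces matrices to real sequences: [entry_norm] bounds each coordinate,
    and conversely the coordinates bound every norm. *)
Lemma cvg_mxP (T : Type) (F : set_system T) (FF : Filter F)
    (f : T -> 'M[R[i]]_d) (L : 'M[R[i]]_d) :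
  cvg_mx F f L <->
  forall b i j, coord b i j (f t) @[t --> F] --> coord b i j L.
Proof.
split=> [fL b i j|fL N hN].
  apply/cvgrPdistC_le => e e0.
  have /cvgr0_norm_le/(_ _ e0) := fL _ matrix_norm_entry_norm.
  apply: filterS => t; rewrite ger0_norm ?(matrix_norm_ge0 matrix_norm_entry_norm)//.
  by apply: le_trans; rewrite -coordN -coordD coord_le_entry_norm.
have h0 b i j : `|coord b i j (f t - L)| @[t --> F] --> (0 : R).
  apply/norm_cvg0P.
  under eq_fun do rewrite coordD coordN.
  by apply/subr_cvg0; exact: fL.
have bound0 : \sum_i \sum_j (`|coord true i j (f t - L)| +
      `|coord false i j (f t - L)|) * N (delta_mx i j) @[t --> F] --> (0 : R).
  apply: cvg_sum0 => i; apply: cvg_sum0 => j.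
  have := cvgMr_tmp (b := N (delta_mx i j)) (cvgD (h0 true i j) (h0 false i j)).
  by rewrite addr0 mul0r; exact.
apply: (squeeze_cvgr _ (cvg_cst 0) bound0).
by apply: nearW => t; rewrite (matrix_norm_ge0 hN) matrix_norm_le_coord.
Qed.

End Coordinates.

(** * Weak Borel summation *)

Section WeakBorel.
Variables (R : realType) (d : nat).
Implicit Types (A : nat -> 'M[R[i]]_d) (S T : 'M[R[i]]_d).

(** Limits are unique, so the choice made by [conv_sum] is forced. *)
Lemma conv_sumE A S : conv_summable_to A S -> conv_sum A = S.
Proof.
move=> AS; rewrite /conv_sum; case: xgetP => [T _ /= AT|/(_ S)//].
apply: coord_inj => b i j.
move: AS AT => /cvg_mxP/(_ b i j) AS /cvg_mxP/(_ b i j) AT.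
exact: cvg_unique AT AS.
Qed.

Definition coord_limit A : 'M[R[i]]_d :=
  mx_of_coord (fun b i j => limn (series (fun k => coord b i j (A k)))).

Lemma conv_summable_coord A :
  (forall b i j, cvgn (series (fun k => coord b i j (A k)))) ->
  conv_summable_to A (coord_limit A).
Proof.
move=> Acvg; apply/cvg_mxP => b i j; rewrite coord_mx_of_coord.
have := Acvg b i j; rewrite -cvg_shiftS.
by under eq_fun do rewrite /= -coord_series; exact.
Qed.

Lemma coord_weak_Borel_term A (x : R) b i j :
  (fun k => coord b i j (weak_Borel_term A x k)) =
  (fun k => exp_coeff x k * coord b i j (partial_sum A k)).
Proof. by apply/funext => k; rewrite coordZ. Qed.

Lemma weak_Borel_summable A S (x : R) : conv_summable_to A S -> 0 < x ->
  conv_summable_to (weak_Borel_term A x) (coord_limit (weak_Borel_term A x)).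
Proof.
move=> /cvg_mxP AS x0; apply: conv_summable_coord => b i j.
rewrite coord_weak_Borel_term; apply: is_cvg_series_exp_coeffM (ltW x0).
exact: cvgP (AS b i j).
Qed.

Lemma conv_summableZ (r : R) A T : conv_summable_to A T ->
  conv_summable_to (fun k => r%:C *: A k) (r%:C *: T).
Proof.
move=> /cvg_mxP AT; apply/cvg_mxP => b i j.
have -> : partial_sum (fun k => r%:C *: A k) = (fun n => r%:C *: partial_sum A n).
  by apply/funext => n; rewrite /partial_sum /series/= scaler_sumr.
under eq_fun do rewrite coordZ.
by rewrite coordZ; apply: cvgMl_tmp; exact: AT.
Qed.

End WeakBorel.

Theorem theorem4p11 (R : realType) (d : nat) (A : nat -> 'M[R[i]%C]_d)
    (S : 'M[R[i]%C]_d) :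
  conv_summable_to A S -> weakly_Borel_summable_to A S.
Proof.
move=> AS; split=> [x x0|].
  by eexists; apply: conv_summableZ; exact: weak_Borel_summable AS x0.
apply/cvg_mxP => b i j.
have /cvg_exp_mean : coord b i j (partial_sum A n) @[n --> \oo] --> coord b i j S.
  by move/cvg_mxP : AS; exact.
apply: cvg_trans; apply: near_eq_cvg; near=> x.
have x0 : 0 < x by near: x; exact: nbhs_pinfty_gt.
rewrite coordZ /weak_Borel (conv_sumE (weak_Borel_summable AS x0)).
by rewrite coord_mx_of_coord coord_weak_Borel_term.
Unshelve. all: by end_near. Qed.
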